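(* Let $\Omega\subseteq\mathbb{C}$ be a domain and $1\le k<n$. Put $k_-=k$ and $k_+=n-k$. For each sign $\pm$, let $Y_0^\pm(\lambda)\in\mathbb{V}(n,k_\pm)$ depend analytically on $\lambda\in\Omega$, let $M_\pm\ge1$, and for $m=0,\ldots,M_\pm-1$ let $S^\pm_{m,m+1}(\lambda)\in\mathbb{C}^{n\times n}$ be matrices depending analytically on $\lambda\in\Omega$ (approximate flow maps, over successive subintervals from $\ell_\pm$ to a matching point $x_\ast$, of a linear system $Y'=A(x;\lambda)Y$) and mapping the successive $n\times k_\pm$ iterates to matrices of rank $k_\pm$. For each $\lambda\in\Omega$ run the Grassmann Gaussian elimination method: apply quasi-optimal Gaussian elimination to obtain \[ Y_0^\pm(\lambda)=y^\pm_{\mathfrak{i}_0^\circ}(\lambda)\,U_0^\pm(\lambda), \] and successively, for $m=0,\ldots,M_\pm-1$, \[ S^\pm_{m,m+1}(\lambda)\,y^\pm_{\mathfrak{i}_m^\circ}(\lambda)=y^\pm_{\mathfrak{i}_{m+1}^\circ}(\lambda)\,U^\pm_{m+1}(\lambda), \] where the multi-indices $\mathfrak{i}_m=\mathfrak{i}_m(\pm)$ may depend on $\lambda$. Set $\hat Y_\pm(x_\ast;\lambda)=S^\pm_{M_\pm-1,M_\pm}(\lambda)\cdots S^\pm_{0,1}(\lambda)\,Y_0^\pm(\lambda)$. Then the approximate Evans function \[ \hat D(\lambda;x_\ast):=\det\bigl(\hat Y_-(x_\ast;\lambda)\;\;\hat Y_+(x_\ast;\lambda)\bigr) \] satisfies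 \[ \hat D(\lambda;x_\ast)=\det\Bigl(y^-_{\mathfrak{i}_{M_-}^\circ}(\lambda)\;\;y^+_{\mathfrak{i}_{M_+}^\circ}(\lambda)\Bigr)\cdot\prod_{m=0}^{M_-}\det U_m^-(\lambda)\cdot\prod_{m=0}^{M_+}\det U_m^+(\lambda), \] and it is an analytic function of $\lambda\in\Omega$.
   Context: $\mathbb{V}(n,k)$ is the set of matrices in $\mathbb{C}^{n\times k}$ of rank $k$. $(P\;\;Q)$ denotes horizontal concatenation of matrices. For a multi-index $\mathfrak{i}\subset\{1,\ldots,n\}$ of cardinality $k$, $\mathfrak{i}^\circ$ is its complement and $y_{\mathfrak{i}^\circ}$ denotes an $n\times k$ matrix whose submatrix of rows indexed by $\mathfrak{i}$ is the identity $I_k$. Quasi-optimal Gaussian elimination applied to $Y\in\mathbb{V}(n,k)$: set $Y^{(1)}=Y$. At step $r=1,\ldots,k$, among the entries of $Y^{(r)}$ outside the previously chosen rows $i_1,\ldots,i_{r-1}$ and columns $j_1,\ldots,j_{r-1}$, choose one of largest magnitude as the pivot $p_{i_rj_r}$, at position $(i_r,j_r)$. Use elementary column operations $c_\ell\to c_\ell-(Y^{(r)}_{i_r,\ell}/p_{i_rj_r})\,c_{j_r}$ for $\ell\notin\{j_1,\ldots,j_r\}$ to make the entries of row $i_r$ in those columns zero, and then $c_{j_r}\to c_{j_r}/p_{i_rj_r}$ to make the pivot entry one; this produces $Y^{(r+1)}$. After step $k$, permute columns so that column $j_r$ becomes column $r$; the submatrix of rows $i_1,\ldots,i_k$ (in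 this order) is then lower triangular with ones on the diagonal, and further elementary column operations turn it into the identity matrix. With $\mathfrak{i}=\{i_1,\ldots,i_k\}$ this yields a decomposition $Y=y_{\mathfrak{i}^\circ}\,U$ with $U\in\mathrm{GL}(k)$ (the identity submatrix being taken with the rows in the order $i_1,\ldots,i_k$). *)

(* Defs.v *)
From HB Require Import structures.
From mathcomp Require Import all_boot all_order all_algebra.
From mathcomp Require Export complex.
From mathcomp Require Import classical_sets topology normedtype derive.
Set Implicit Arguments.
Unset Strict Implicit.
Unset Printing Implicit Defensive.
Import Order.TTheory GRing.Theory Num.Theory.
Import numFieldNormedType.Exports.

Local Open Scope classical_set_scope.
Local Open Scope ring_scope.
Local Open Scope complex_scope.

(** * Domains and analytic functions *)

(* [R[i]^o] is [R[i]] with its canonical structure of normed space over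
   itself, so that [derivable f z 1] is complex differentiability at [z]. *)
Definition domain (R : rcfType) (Omega : set R[i]) : Prop :=
  [/\ open (Omega : set R[i]^o), connected (Omega : set R[i]^o)
    & Omega !=set0].

Definition analytic_on (R : rcfType) (Omega : set R[i]) (f : R[i] -> R[i]) :
    Prop :=
  forall z, Omega z -> derivable (f : R[i]^o -> R[i]^o) z 1.

Definition mx_analytic_on (R : rcfType) (Omega : set R[i]) (m n : nat)
    (A : R[i] -> 'M[R[i]]_(m, n)) : Prop :=
  forall i j, analytic_on Omega (fun z => A z i j).

(** * Quasi-optimal Gaussian elimination *)

Section GaussianElimination.

Variables (F : numFieldType) (n k : nat).

(* A pivot sequence [p] gives the position [(i_{r+1}, j_{r+1}) = p r] of the
   pivot of step [r+1]; only the values at [r < k] matter. *)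
Implicit Types (p : nat -> 'I_n * 'I_k) (Y : 'M[F]_(n, k)).

Definition used_rows p r : {set 'I_n} := [set (p s).1 | s : 'I_r].
Definition used_cols p r : {set 'I_k} := [set (p s).2 | s : 'I_r].

(* The elementary column operations of one step, with pivot at [ij] and
   previously used columns [J]: their coefficients are read off from [Y], and
   they are applied to the columns of [X]. *)
Definition col_step q Y (ij : 'I_n * 'I_k) (J : {set 'I_k})
    (X : 'M[F]_(q, k)) : 'M[F]_(q, k) :=
  let: (i, j) := ij in
  \matrix_(a, l)
    if l == j then X a j / Y i j
    else if l \in J then X a l
    else X a l - (Y i l / Y i j) * X a j.

(* [reduced p Y r] is the matrix Y^(r+1), obtained after [r] steps. *)
Fixpoint reduced p Y (r : nat) : 'M[F]_(n, k) :=
  if r is s.+1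
  then col_step (reduced p Y s) (p s) (used_cols p s) (reduced p Y s)
  else Y.

(* The same operations applied to the identity matrix: a matrix [T] of column
   operations with [reduced p Y r = Y *m T]. *)
Fixpoint col_ops p Y (r : nat) : 'M[F]_k :=
  if r is s.+1
  then col_step (reduced p Y s) (p s) (used_cols p s) (col_ops p Y s)
  else 1%:M.

Definition quasi_optimal p Y : Prop :=
  forall r, (r < k)%N ->
    [/\ (p r).1 \notin used_rows p r,
        (p r).2 \notin used_cols p r
      & forall a l, a \notin used_rows p r -> l \notin used_cols p r ->
          `|reduced p Y r a l| <= `|reduced p Y r (p r).1 (p r).2| ].

Definition sort_cols q p (X : 'M[F]_(q, k)) : 'M[F]_(q, k) :=
  colsub (fun r : 'I_k => (p r).2) X.

Definition pivot_rows p Y : 'M[F]_k := rowsub (fun r : 'I_k => (p r).1) Y.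

(* Right multiplication by the inverse of the (unit lower triangular) pivot
   submatrix performs the final column operations, which turn this submatrix
   into the identity. *)
Definition final_ops p Y : 'M[F]_k :=
  invmx (pivot_rows p (sort_cols p (reduced p Y k))).

(* The factors of the decomposition Y = y_{i°} U: [ge_rep] is the outcome of
   the elimination and [ge_fac] undoes all its column operations. *)
Definition ge_rep p Y : 'M[F]_(n, k) :=
  sort_cols p (reduced p Y k) *m final_ops p Y.

Definition ge_fac p Y : 'M[F]_k :=
  invmx (sort_cols p (col_ops p Y k) *m final_ops p Y).

(** * The Grassmann Gaussian elimination method *)

Implicit Types (S : nat -> 'M[F]_n) (P : nat -> nat -> 'I_n * 'I_k).

(* [S m] stands for S_{m,m+1}, and [P m] for the pivots of the [m]-th
   elimination, whose input is [gge_input Y S P m]: the initial matrix for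
   [m = 0], and S_{m-1,m} y_{m-1} afterwards. *)
Fixpoint gge_input Y S P (m : nat) : 'M[F]_(n, k) :=
  if m is l.+1 then S l *m ge_rep (P l) (gge_input Y S P l) else Y.

Definition gge_rep Y S P m := ge_rep (P m) (gge_input Y S P m).
Definition gge_fac Y S P m := ge_fac (P m) (gge_input Y S P m).

(* S_{m-1,m} ... S_{0,1} Y *)
Fixpoint flow Y S (m : nat) : 'M[F]_(n, k) :=
  if m is l.+1 then S l *m flow Y S l else Y.

End GaussianElimination.

(* det (P Q); the cast identifies the width k + (n - k) with n. *)
Definition det_hcat (F : numFieldType) (n k : nat) (kn : (k <= n)%N)
    (P : 'M[F]_(n, k)) (Q : 'M[F]_(n, n - k)) : F :=
  \det (castmx (erefl n, subnKC kn) (row_mx P Q)).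

(* Main.v *)
Require Import Defs.
From mathcomp Require Import all_boot all_order all_algebra.
From mathcomp Require Import classical_sets reals.
From mathcomp Require Import perm topology normedtype derive.
Import GRing.Theory Num.Theory numFieldNormedType.Exports.
Local Open Scope ring_scope.
Local Open Scope complex_scope.

(** The pivots are nonzero because the matrices keep full rank: an unused column
of [reduced p Y r] is nonzero and vanishes on the used rows, so the maximal entry
among unused rows and columns is nonzero.  Hence all column operations are
invertible, [Y = ge_rep p Y *m ge_fac p Y], and the flow telescopes into
[gge_rep * U_M * ... * U_0], so the determinants factor out.  Analyticity does not
involve the elimination, whose pivots may jump with lambda: the Evans function is
a polynomial in the analytic entries of the initial matrices and flow maps. *)

(** * Quasi-optimal elimination as an exact factorization *)

Section Elimination.

Variables (F : numFieldType) (n k : nat).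
Implicit Types (p : nat -> 'I_n * 'I_k) (Y : 'M[F]_(n, k)).

Lemma used_rowsP p r (a : 'I_n) :
  reflect (exists2 s, (s < r)%N & a = (p s).1) (a \in used_rows p r).
Proof.
apply: (iffP imsetP) => [[s _ ->]|[s sr ->]]; first by exists s.
by exists (Ordinal sr).
Qed.

Lemma used_colsP p r (l : 'I_k) :
  reflect (exists2 s, (s < r)%N & l = (p s).2) (l \in used_cols p r).
Proof.
apply: (iffP imsetP) => [[s _ ->]|[s sr ->]]; first by exists s.
by exists (Ordinal sr).
Qed.

Lemma used_colsS p r l :
  (l \in used_cols p r.+1) = (l == (p r).2) || (l \in used_cols p r).
Proof.
apply/used_colsP/orP => [[s]|[/eqP ->|/used_colsP[s sr ->]]].
- rewrite ltnS leq_eqVlt => /orP[/eqP -> ->|sr ->]; first by left.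
  by right; apply/used_colsP; exists s.
- by exists r.
- by exists s => //; apply: ltnW.
Qed.

Lemma used_colsW p r s l : (r <= s)%N ->
  l \notin used_cols p s -> l \notin used_cols p r.
Proof.
move=> rs; apply: contra => /used_colsP[t tr ->].
by apply/used_colsP; exists t => //; apply: leq_trans rs.
Qed.

(** The coefficients come from [Y], not from [X], so the step is linear in [X] and one fixed matrix
    acts both on the reduced matrix and on the accumulated operations. *)
Lemma col_stepM {q} Y (ij : 'I_n * 'I_k) (J : {set 'I_k}) (X : 'M[F]_(q, k)) :
  col_step Y ij J X = X *m col_step Y ij J 1%:M.
Proof.
case: ij => i j; apply/matrixP => a l; rewrite !mxE.
have sumX b : \sum_c X a c * (1%:M : 'M_k) c b = X a b.
  rewrite (bigD1 b) //= big1 => [|c /negPf cb]; rewrite !mxE ?cb ?mulr0 //.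
  by rewrite eqxx mulr1 addr0.
under eq_bigr do rewrite mxE.
case: (l == j); first by under eq_bigr do rewrite mulrA; rewrite -mulr_suml sumX.
case: (l \in J); first by rewrite sumX.
under eq_bigr do rewrite mulrBr mulrCA.
by rewrite sumrB -mulr_sumr !sumX.
Qed.

(** A row vector killed by the step has zero entry at the pivot column, where the step only divides
    by the pivot; the other columns then change nothing, so the vector is zero. *)
Lemma col_step_unitmx Y (ij : 'I_n * 'I_k) (J : {set 'I_k}) :
  Y ij.1 ij.2 != 0 -> col_step Y ij J 1%:M \in unitmx.
Proof.
case: ij => i j Yij; rewrite -row_free_unit; apply: inj_row_free => v.
rewrite -col_stepM => /rowP v0.
have vj : v 0 j = 0.
  have := v0 j; rewrite !mxE eqxx => /eqP.
  by rewrite mulf_eq0 invr_eq0 (negPf (Yij : Y i j != 0)) orbF => /eqP.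
apply/rowP => l; have := v0 l; rewrite !mxE.
case: eqP => [->|_]; first by [].
by case: (l \in J); rewrite // vj mulr0 subr0.
Qed.

Lemma reducedM p Y r : reduced p Y r = Y *m col_ops p Y r.
Proof.
elim: r => [|r IH] /=; first by rewrite mulmx1.
by rewrite [LHS]col_stepM [in RHS]col_stepM mulmxA -IH.
Qed.

Lemma exists_unused_col p r : (r < k)%N -> exists l, l \notin used_cols p r.
Proof.
move=> rk; apply/existsP; rewrite -negb_forall; apply/negP => /forallP allJ.
have : (#|used_cols p r| <= r)%N by rewrite -[leqRHS]card_ord leq_imset_card.
suff -> : #|used_cols p r| = k by rewrite leqNgt rk.
by rewrite -[RHS]card_ord; apply: eq_card => l; rewrite allJ.
Qed.

Lemma row_full_col_neq0 Y j : row_full Y -> exists a, Y a j != 0.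
Proof.
move=> fullY; apply/existsP; apply: contraT; rewrite negb_exists => /forallP Y0.
have : delta_mx j (0 : 'I_1) = 0 :> 'M[F]_(k, 1).
  apply: (row_full_inj fullY); rewrite mulmx0 -colE.
  by apply/colP => a; rewrite !mxE; apply/eqP; rewrite -[_ == 0]negbK Y0.
by move=> /matrixP/(_ j 0)/eqP; rewrite !mxE !eqxx oner_eq0.
Qed.

Lemma pivot_neq0 p Y r : (r < k)%N -> quasi_optimal p Y ->
  row_full (reduced p Y r) ->
  (forall s l, (s < r)%N -> l \notin used_cols p s.+1 ->
     reduced p Y r (p s).1 l = 0) ->
  reduced p Y r (p r).1 (p r).2 != 0.
Proof.
move=> rk qo full_r zero_r; have [l lJ] := exists_unused_col p r rk.
have [a al_neq0] := row_full_col_neq0 _ l full_r.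
have aI : a \notin used_rows p r.
  apply: contra al_neq0 => /used_rowsP[s sr ->].
  by rewrite zero_r //; apply: used_colsW lJ.
have [_ _ /(_ a l aI lJ)] := qo r rk.
by apply: contraTneq => ->; rewrite normr0 normr_le0.
Qed.

Lemma elimination_invariant p Y r : (r <= k)%N -> row_full Y ->
  quasi_optimal p Y ->
  [/\ col_ops p Y r \in unitmx,
      forall s l, (s < r)%N -> l \notin used_cols p s.+1 ->
        reduced p Y r (p s).1 l = 0
    & forall s, (s < r)%N -> reduced p Y r (p s).1 (p s).2 = 1].
Proof.
move=> rk fullY qo; elim: r => [|r IH] in rk *; first by rewrite unitmx1; split.
have [unit_r zero_r one_r] := IH (ltnW rk).
have pivot : reduced p Y r (p r).1 (p r).2 != 0.
  apply: pivot_neq0 => //; rewrite reducedM -col_leq_rank.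
  by rewrite mxrankMfree ?row_free_unit // col_leq_rank.
have [_ jrJ _] := qo r rk.
split=> [|s l|s] /=.
- by rewrite col_stepM unitmx_mul unit_r col_step_unitmx.
- case pr: (p r) => [i j]; rewrite pr /= in pivot jrJ; rewrite !mxE.
  rewrite ltnS leq_eqVlt => /orP[/eqP -> | sr lJ].
    rewrite used_colsS pr /= negb_or => /andP[/negPf -> /negPf ->].
    by rewrite divfK // subrr.
  (* In an older pivot row the new pivot column is already zero, so scaling it or subtracting its
     multiples preserves the zeros. *)
  have jJ : j \notin used_cols p s.+1 by apply: used_colsW jrJ.
  by rewrite !zero_r // mul0r mulr0 subr0 !if_same.
- case pr: (p r) => [i j]; rewrite pr /= in pivot jrJ; rewrite !mxE.
  rewrite ltnS leq_eqVlt => /orP[/eqP -> | sr].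
    by rewrite pr eqxx divff.
  (* Earlier pivot columns are left untouched by the step. *)
  have sJ : (p s).2 \in used_cols p r by apply/used_colsP; exists s.
  by rewrite sJ one_r // ifN //; apply: contraNneq jrJ => <-.
Qed.

(** Each pivot avoids all earlier pivot columns. Injectivity makes [sort_cols] a genuine column
    permutation, hence invertible. *)
Lemma pivot_cols_inj p Y : quasi_optimal p Y ->
  injective (fun r : 'I_k => (p r).2).
Proof.
move=> qo; suff neq (r s : 'I_k) : (r < s)%N -> (p r).2 != (p s).2.
  move=> r s /= eq_rs; apply/val_inj; case: (ltngtP r s) => // /neq;
  by rewrite eq_rs eqxx.
move=> rs; have [_ + _] := qo s (ltn_ord s); apply: contraNneq => <-.
by apply/used_colsP; exists r.
Qed.

Lemma ge_decomposition p Y : \rank Y = k -> quasi_optimal p Y ->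
  Y = ge_rep p Y *m ge_fac p Y.
Proof.
move=> rkY qo; have fullY : row_full Y by rewrite /row_full rkY.
have [unit_ops zero_k one_k] := elimination_invariant p Y k (leqnn k) fullY qo.
have unit_sort : sort_cols p (col_ops p Y k) \in unitmx.
  have injp := pivot_cols_inj p Y qo.
  have -> : sort_cols p (col_ops p Y k) = col_perm (perm injp) (col_ops p Y k).
    by apply/matrixP => a l; rewrite !mxE permE.
  by rewrite col_permE unitmx_mul unit_ops unitmx_perm.
have unit_final : final_ops p Y \in unitmx.
  rewrite unitmx_inv unitmxE det_trig.
    by rewrite big1 ?unitr1 // => s _; rewrite !mxE one_k.
  apply/is_trig_mxP => s r sr; rewrite !mxE zero_k //.
  by have [_ + _] := qo r (ltn_ord r); apply: used_colsW.
(* [ge_rep] is [Y] times exactly the matrix that [ge_fac] inverts. *)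
rewrite /ge_rep /ge_fac reducedM /sort_cols -mulmx_colsub -/(sort_cols _ _).
by rewrite -(mulmxA Y) mulmxK // unitmx_mul unit_sort.
Qed.

(** Each elimination contributes its factor on the left of those before it. Only the determinant of
    [U] matters later, so [U] stays existential. *)
Lemma flow_decomposition (Y : 'M[F]_(n, k)) (S : nat -> 'M[F]_n)
    (P : nat -> nat -> 'I_n * 'I_k) M :
  (forall m, (m <= M)%N -> quasi_optimal (P m) (gge_input Y S P m)) ->
  (forall m, (m <= M)%N -> \rank (gge_input Y S P m) = k) ->
  exists2 U, flow Y S M = gge_rep Y S P M *m U
    & \det U = \prod_(0 <= m < M.+1) \det (gge_fac Y S P m).
Proof.
elim: M => [|M IH] qo rk.
  exists (gge_fac Y S P 0); last by rewrite big_nat1.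
  by apply: ge_decomposition; [apply: (rk 0%N)|apply: (qo 0%N)].
have [U flowE detU] :=
  IH (fun m mM => qo m (leqW mM)) (fun m mM => rk m (leqW mM)).
exists (gge_fac Y S P M.+1 *m U).
  rewrite mulmxA -(ge_decomposition _ _ (rk _ (leqnn _)) (qo _ (leqnn _))) /=.
  by rewrite flowE mulmxA.
by rewrite det_mulmx detU mulrC [RHS]big_nat_recr.
Qed.

End Elimination.

Lemma det_hcat_mul (F : numFieldType) (n k : nat) (kn : (k <= n)%N)
    (P : 'M[F]_(n, k)) (Q : 'M[F]_(n, n - k)) U V :
  det_hcat kn (P *m U) (Q *m V) = det_hcat kn P Q * \det U * \det V.
Proof.
(* Generalizing the width [n - k] lets the equation [k + l = n] be eliminated, so that the cast
   disappears; what remains is right multiplication by the block diagonal matrix of [U] and [V]. *)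
rewrite /det_hcat; move: (n - k)%N (subnKC kn) Q V => l e.
case: n / e P kn => P _ Q V.
rewrite !castmx_id -mulrA -(det_ublock U 0) -det_mulmx mul_row_block.
by rewrite !mulmx0 addr0 add0r.
Qed.

(** * Closure of analyticity under matrix products and determinants *)

Section Analytic.

Variables (R : rcfType) (Omega : set R[i]).

Lemma analytic_on_cst c : analytic_on Omega (fun=> c).
Proof. by move=> z _; apply: derivable_cst. Qed.

Lemma analytic_onD f g : analytic_on Omega f -> analytic_on Omega g ->
  analytic_on Omega (fun z => f z + g z).
Proof. by move=> f_an g_an z Oz; apply: derivableD; [apply: f_an|apply: g_an]. Qed.

Lemma analytic_onM f g : analytic_on Omega f -> analytic_on Omega g ->
  analytic_on Omega (fun z => f z * g z).
Proof. by move=> f_an g_an z Oz; apply: derivableM; [apply: f_an|apply: g_an]. Qed.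

Lemma analytic_on_sum (I : Type) (r : seq I) (f : I -> R[i] -> R[i]) :
  (forall i, analytic_on Omega (f i)) ->
  analytic_on Omega (fun z => \sum_(i <- r) f i z).
Proof.
move=> f_an; elim: r => [|i r IH].
  under [X in analytic_on _ X]boolp.eq_fun do rewrite big_nil.
  exact: analytic_on_cst.
under [X in analytic_on _ X]boolp.eq_fun do rewrite big_cons.
exact: (analytic_onD _ _ (f_an i) IH).
Qed.

Lemma analytic_on_prod (I : Type) (r : seq I) (f : I -> R[i] -> R[i]) :
  (forall i, analytic_on Omega (f i)) ->
  analytic_on Omega (fun z => \prod_(i <- r) f i z).
Proof.
move=> f_an; elim: r => [|i r IH].
  under [X in analytic_on _ X]boolp.eq_fun do rewrite big_nil.
  exact: analytic_on_cst.
under [X in analytic_on _ X]boolp.eq_fun do rewrite big_cons.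
exact: (analytic_onM _ _ (f_an i) IH).
Qed.

Lemma mx_analytic_on_mul {m n p} (A : R[i] -> 'M[R[i]]_(m, n))
    (B : R[i] -> 'M[R[i]]_(n, p)) :
  mx_analytic_on Omega A -> mx_analytic_on Omega B ->
  mx_analytic_on Omega (fun z => A z *m B z).
Proof.
move=> A_an B_an i j.
under [X in analytic_on _ X]boolp.eq_fun do rewrite mxE.
by apply: analytic_on_sum => l; apply: analytic_onM.
Qed.

Lemma analytic_on_det n (A : R[i] -> 'M[R[i]]_n) :
  mx_analytic_on Omega A -> analytic_on Omega (fun z => \det (A z)).
Proof.
(* [\det] unfolds to the Leibniz sum; the sign of each permutation is a constant function. *)
move=> A_an; apply: analytic_on_sum => s.
apply: analytic_onM; first exact: analytic_on_cst.
by apply: analytic_on_prod.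
Qed.

Lemma mx_analytic_on_flow {n k} (Y : R[i] -> 'M[R[i]]_(n, k))
    (S : R[i] -> nat -> 'M[R[i]]_n) M :
  mx_analytic_on Omega Y ->
  (forall m, (m < M)%N -> mx_analytic_on Omega (fun z => S z m)) ->
  mx_analytic_on Omega (fun z => flow (Y z) (S z) M).
Proof.
move=> Y_an; elim: M => [//|M IH] S_an /=.
apply: mx_analytic_on_mul; first exact: S_an.
by apply: IH => m mM; apply: S_an; apply: leqW.
Qed.

Lemma analytic_on_det_hcat n k (kn : (k <= n)%N)
    (P : R[i] -> 'M[R[i]]_(n, k)) (Q : R[i] -> 'M[R[i]]_(n, n - k)) :
  mx_analytic_on Omega P -> mx_analytic_on Omega Q ->
  analytic_on Omega (fun z => det_hcat kn (P z) (Q z)).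
Proof.
move=> P_an Q_an; apply: analytic_on_det => i j.
under [X in analytic_on _ X]boolp.eq_fun do rewrite castmxE mxE.
(* Whether a column comes from [P] or from [Q] does not depend on [z]. *)
by case: split => l /=; [apply: P_an|apply: Q_an].
Qed.

End Analytic.

Theorem mainTheorem4 (R : realType) (Omega : set R[i]) (n k : nat)
    (hOmega : domain Omega) (hk : (1 <= k)%N) (hkn : (k < n)%N)
    (* initial matrices, depending on lambda *)
    (Ym : R[i] -> 'M[R[i]]_(n, k)) (Yp : R[i] -> 'M[R[i]]_(n, n - k))
    (hYm : mx_analytic_on Omega Ym) (hYp : mx_analytic_on Omega Yp)
    (rYm : forall z, Omega z -> \rank (Ym z) = k)
    (rYp : forall z, Omega z -> \rank (Yp z) = (n - k)%N)
    (* approximate flow maps *)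
    (Mm Mp : nat) (hMm : (1 <= Mm)%N) (hMp : (1 <= Mp)%N)
    (Sm Sp : R[i] -> nat -> 'M[R[i]]_n)
    (hSm : forall m, (m < Mm)%N -> mx_analytic_on Omega (fun z => Sm z m))
    (hSp : forall m, (m < Mp)%N -> mx_analytic_on Omega (fun z => Sp z m))
    (* pivot positions, for each lambda, elimination and step *)
    (pm : R[i] -> nat -> nat -> 'I_n * 'I_k)
    (pp : R[i] -> nat -> nat -> 'I_n * 'I_(n - k))
    (qm : forall z, Omega z -> forall m, (m <= Mm)%N ->
        quasi_optimal (pm z m) (gge_input (Ym z) (Sm z) (pm z) m))
    (qp : forall z, Omega z -> forall m, (m <= Mp)%N ->
        quasi_optimal (pp z m) (gge_input (Yp z) (Sp z) (pp z) m))
    (* the flow maps send the successive iterates to full-rank matrices *)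
    (rSm : forall z, Omega z -> forall m, (m < Mm)%N ->
        \rank (Sm z m *m gge_rep (Ym z) (Sm z) (pm z) m) = k)
    (rSp : forall z, Omega z -> forall m, (m < Mp)%N ->
        \rank (Sp z m *m gge_rep (Yp z) (Sp z) (pp z) m) = (n - k)%N) :
  let D z := det_hcat (ltnW hkn) (flow (Ym z) (Sm z) Mm)
                                 (flow (Yp z) (Sp z) Mp) in
  (forall z, Omega z ->
     D z = det_hcat (ltnW hkn) (gge_rep (Ym z) (Sm z) (pm z) Mm)
                               (gge_rep (Yp z) (Sp z) (pp z) Mp)
           * \prod_(0 <= m < Mm.+1) \det (gge_fac (Ym z) (Sm z) (pm z) m)
           * \prod_(0 <= m < Mp.+1) \det (gge_fac (Yp z) (Sp z) (pp z) m))
  /\ analytic_on Omega D.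
Proof.
move=> D; split=> [z Oz|]; last first.
  by apply: analytic_on_det_hcat; apply: mx_analytic_on_flow.
have [|Um flowm <-] := flow_decomposition _ _ _ _ _ _ _ (qm z Oz).
  (* The input of elimination 0 is the initial matrix, and that of elimination [m.+1] is the image
     of an iterate under a flow map. *)
  by case=> [_|m mM]; [apply: rYm|apply: rSm].
have [|Up flowp <-] := flow_decomposition _ _ _ _ _ _ _ (qp z Oz).
  by case=> [_|m mM]; [apply: rYp|apply: rSp].
by rewrite /D flowm flowp det_hcat_mul.
Qed.
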